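(* The connective motivic Segre classes are not the $\beta$-homogenizations of the motivic Segre classes: in $\bigoplus_{\mu\in\Gamma}\mathrm{Frac}\bigl(\mathbb Z[\beta,\beta^{-1}]\llbracket\Lambda\rrbracket_{F_C}\llbracket x_q\rrbracket\bigr)$, with $q:=x_q$ and $e^\lambda:=1-\beta x_\lambda$ for $\lambda\in\Lambda$, it is not the case that $S_w=\beta^{-\ell(w)}S_w^{K}$ for all $w\in\Gamma$.
   Context: **Combinatorics.** Fix $n$, $d\ge 1$ and $0=i_0<i_1<\dots<i_d<i_{d+1}=n$; put $p_j=i_j-i_{j-1}$ (these data describe the $d$-step flag variety $G/P$ of $\mathbb C^n$ with dimensions $i_1<\dots<i_d$). $\Lambda=\bigoplus_{i=1}^n\mathbb Z y_i$, $\alpha_i=y_i-y_{i+1}$, $\Sigma_\Theta^+=\{y_i-y_j: i<j,\ i\le i_m<j\text{ for some }m\}$. $W=S_n$ acts on $\Lambda$ by $w(y_i)=y_{w(i)}$; $r_i=(i,i+1)$. $\Gamma$ is the set of words of length $n$ in the letters $0,\dots,d$ in which the letter $d+1-j$ occurs $p_j$ times ($1\le j\le d+1$). $W$ acts on $\Gamma$ by $(w\lambda)_{w(i)}=\lambda_i$. $w_0:=d^{p_1}(d-1)^{p_2}\cdots 0^{p_{d+1}}$. For $\lambda\in\Gamma$, $\ell(\lambda)=\#\{i<j:\lambda_i>\lambda_j\}$, and $w_\lambda\in W$ is the minimal length permutation with $\lambda=w_\lambda\cdot w_0$. **Formal group algebra.** For a commutative ring $S$ and a formal group law $F$ over $S$,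 $S\llbracket\Lambda\rrbracket_F$ is the quotient of $S\llbracket x_\lambda:\lambda\in\Lambda\rrbracket$ by the closure of the ideal generated by $x_0$ and all $x_{\lambda+\mu}-F(x_\lambda,x_\mu)$; $W$ acts by $w(x_\lambda)=x_{w(\lambda)}$ and trivially on $x_q$. $F_C(x,y)=x+y-\beta xy$. The ring $\mathbb Z[\beta]\llbracket\Lambda\rrbracket_{F_C}\llbracket x_q\rrbracket$ embeds in $\mathbb Z[\beta,\beta^{-1}]\llbracket\Lambda\rrbracket_{F_C}\llbracket x_q\rrbracket$. **Connective motivic Segre classes.** Put $(\partial_i f)|_\mu=(1-x_q^2)\bigl(\frac{f|_\mu}{x_{-\alpha_i}}+\frac{r_i(f|_{r_i\mu})}{x_{\alpha_i}}\bigr)+x_q^2\,r_i(f|_{r_i\mu})$; these satisfy the braid relations, giving $\partial_w$ for $w\in W$. $S_{w_0}|_{w_0}=\prod_{\alpha\in\Sigma_\Theta^+}\frac{x_{-\alpha}}{1-x_q^2(1-x_{-\alpha})}$, $S_{w_0}|_\mu=0$ for $\mu\ne w_0$, $S_\lambda:=\partial_{w_\lambda}(S_{w_0})$. **Motivic Segre classes (restricted to fixed points).** $S^K_{w_0}|_{w_0}=\prod_{\alpha\in\Sigma^+_\Theta}\frac{1-e^{-\alpha}}{1-q^2e^{-\alpha}}$, $S^K_{w_0}|_\mu=0$ for $\mu\ne w_0$, $S^K_\lambda=\delta^K_{w_\lambda}(S^K_{w_0})$, where $(\delta_i^Kf)|_\mu=\frac{1-q^2}{1-e^{-\alpha_i}}f|_\mu+\frac{1-q^2e^{\alpha_i}}{1-e^{\alpha_i}}r_i(f|_{r_i\mu})$.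 The $\beta$-homogenization of $S^K_w$ is $\beta^{-\ell(w)}S_w^K$. *)

(* Defs.v *)
From HB Require Import structures.
From mathcomp Require Import all_boot all_order all_algebra all_fingroup.
From mathcomp Require Import generic_quotient ring_quotient finmap boolp.
From mathcomp Require Import monalg.
From mathcomp Require Import ring zify.

Set Implicit Arguments.
Unset Strict Implicit.
Unset Printing Implicit Defensive.

Import GRing.Theory.
Local Open Scope ring_scope.
Local Open Scope quotient_scope.

Record fps (A : Type) := Fps { fcoef : nat -> A }.

HB.instance Definition _ (A : Type) := gen_eqMixin (fps A).
HB.instance Definition _ (A : Type) := gen_choiceMixin (fps A).

Lemma fpsP (A : Type) (f g : fps A) : fcoef f =1 fcoef g -> f = g.
Proof. by case: f g => [f] [g] /= /funext ->. Qed.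

Section FpsRing.
Variable A : comNzRingType.
Implicit Types f g h : fps A.

Definition fps_zero : fps A := Fps (fun=> 0).
Definition fps_opp f : fps A := Fps (fun k => - fcoef f k).
Definition fps_add f g : fps A := Fps (fun k => fcoef f k + fcoef g k).
Definition fps_const (a : A) : fps A := Fps (fun k => if k is 0 then a else 0).
Definition fps_var : fps A := Fps (fun k => (k == 1%N)%:R).
Definition fps_mul f g : fps A :=
  Fps (fun k => \sum_(i < k.+1) fcoef f i * fcoef g (k - i)).

Lemma fps_addA : associative fps_add.
Proof. by move=> f g h; apply: fpsP => k /=; rewrite addrA. Qed.
Lemma fps_addC : commutative fps_add.
Proof. by move=> f g; apply: fpsP => k /=; rewrite addrC. Qed.
Lemma fps_add0 : left_id fps_zero fps_add.
Proof. by move=> f; apply: fpsP => k /=; rewrite add0r. Qed.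
Lemma fps_addN : left_inverse fps_zero fps_opp fps_add.
Proof. by move=> f; apply: fpsP => k /=; rewrite addNr. Qed.

HB.instance Definition _ :=
  GRing.isZmodule.Build (fps A) fps_addA fps_addC fps_add0 fps_addN.

Definition fps_trunc N f : {poly A} := \poly_(i < N) fcoef f i.

Lemma fps_mulE N f g k : (k < N)%N ->
  fcoef (fps_mul f g) k = (fps_trunc N f * fps_trunc N g)`_k.
Proof.
move=> kN; rewrite coefM /=; apply: eq_bigr => i _; rewrite !coef_poly.
rewrite (leq_ltn_trans (leq_ord i) kN).
by rewrite (leq_ltn_trans (leq_subr i k) kN).
Qed.

Lemma fps_mulC : commutative fps_mul.
Proof. by move=> f g; apply: fpsP => k; rewrite !(@fps_mulE k.+1) // mulrC. Qed.

Lemma fps_mulA : associative fps_mul.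
Proof.
move=> f g h; apply: fpsP => k.
transitivity ((fps_trunc k.+1 f * (fps_trunc k.+1 g * fps_trunc k.+1 h))`_k).
  rewrite coefM; apply: eq_bigr => i _; rewrite coef_poly ltn_ord.
  by congr (_ * _); apply: fps_mulE; rewrite ltnS leq_subr.
rewrite mulrA coefM; apply: eq_bigr => i _.
rewrite (@fps_mulE k.+1) // coef_poly.
by rewrite ltnS leq_subr.
Qed.

Lemma fps_mul1 : left_id (fps_const 1) fps_mul.
Proof.
move=> f; apply: fpsP => k /=.
by rewrite big_ord_recl /= subn0 mul1r big1 ?addr0 // => i _; rewrite mul0r.
Qed.

Lemma fps_mulDl : left_distributive fps_mul +%R.
Proof.
move=> f g h; apply: fpsP => k /=; rewrite -big_split /=.
by apply: eq_bigr => i _; rewrite mulrDl.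
Qed.

Lemma fps_one_neq0 : fps_const 1 != 0.
Proof.
apply/eqP => /(congr1 (fun f => fcoef f 0)) /= /eqP.
by rewrite oner_eq0.
Qed.

HB.instance Definition _ := GRing.Zmodule_isComNzRing.Build (fps A)
  fps_mulA fps_mulC fps_mul1 fps_mulDl fps_one_neq0.

Lemma fcoef0 k : fcoef (0 : fps A) k = 0. Proof. by []. Qed.
Lemma fcoefN f k : fcoef (- f) k = - fcoef f k. Proof. by []. Qed.
Lemma fcoefD f g k : fcoef (f + g) k = fcoef f k + fcoef g k. Proof. by []. Qed.
Lemma fcoefB f g k : fcoef (f - g) k = fcoef f k - fcoef g k. Proof. by []. Qed.
Lemma fcoef1 k : fcoef (1 : fps A) k = if k is 0 then 1 else 0. Proof. by []. Qed.
Lemma fcoefM f g k :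
  fcoef (f * g) k = \sum_(i < k.+1) fcoef f i * fcoef g (k - i).
Proof. by []. Qed.

End FpsRing.

Section FpsMap.
Variables (A B : comNzRingType) (phi : {rmorphism A -> B}).

Definition fps_map (f : fps A) : fps B := Fps (fun k => phi (fcoef f k)).

Lemma fps_map_is_zmod_morphism : zmod_morphism fps_map.
Proof. by move=> f g; apply: fpsP => k /=; rewrite rmorphB. Qed.

Lemma fps_map_is_monoid_morphism : monoid_morphism fps_map.
Proof.
split=> [|f g]; apply: fpsP => k /=; first by case: k => [|k]; rewrite ?rmorph1 ?rmorph0.
by rewrite rmorph_sum; apply: eq_bigr => i _; rewrite rmorphM.
Qed.

HB.instance Definition _ := GRing.isZmodMorphism.Build _ _ fps_map
  fps_map_is_zmod_morphism.
HB.instance Definition _ := GRing.isMonoidMorphism.Build _ _ fps_map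
  fps_map_is_monoid_morphism.

End FpsMap.

Definition regular (R : comNzRingType) (s : R) := forall a : R, a * s = 0 -> a = 0.

Record mulset (R : comNzRingType) := Mulset {
  mulset_pred :> R -> Prop;
  mulset1 : mulset_pred 1;
  mulsetM : forall s t, mulset_pred s -> mulset_pred t -> mulset_pred (s * t);
  mulset_regular : forall s, mulset_pred s -> regular s }.

Section Localization.
Variables (R : comNzRingType) (D : mulset R).

Definition lpair := {x : R * R | `[< D x.2 >]}.
Implicit Types p q r : lpair.

Definition lnum p := (val p).1.
Definition lden p := (val p).2.

Lemma ldenP p : D (lden p).
Proof. exact/asboolP/(valP p). Qed.

Definition Lpair a s (Ds : D s) : lpair := exist _ (a, s) (introT (asboolP _) Ds).

Lemma lnumE a s (Ds : D s) : lnum (Lpair a Ds) = a. Proof. by []. Qed.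
Lemma ldenE a s (Ds : D s) : lden (Lpair a Ds) = s. Proof. by []. Qed.

Lemma mulset_inj s a b : D s -> a * s = b * s -> a = b.
Proof.
move=> Ds e; apply/eqP; rewrite -subr_eq0; apply/eqP.
by apply: (mulset_regular Ds); rewrite mulrBl e subrr.
Qed.

Definition lequiv p q := lnum p * lden q == lnum q * lden p.

Lemma lequiv_is_equiv : equiv_class_of lequiv.
Proof.
rewrite /lequiv; split=> [p|p q|q p r]; [exact: eqxx|exact: eq_sym|].
move=> /eqP epq /eqP eqr; apply/eqP; apply: (mulset_inj (ldenP q)).
by rewrite mulrAC epq mulrAC eqr mulrAC.
Qed.

Canonical lequiv_equiv := EquivRelPack lequiv_is_equiv.
Canonical lequiv_encModRel := defaultEncModRel lequiv.

Definition loc := {eq_quot lequiv}.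
HB.instance Definition _ : EqQuotient _ lequiv loc := EqQuotient.on loc.
HB.instance Definition _ := Choice.on loc.

Definition locpi p : loc := \pi p.

Lemma locpiP p q : reflect (locpi p = locpi q) (lequiv p q).
Proof.
by apply: (iffP idP) => [h|/eqP]; [apply/eqP|]; rewrite /locpi piE.
Qed.

Lemma locpi_repr (x : loc) : locpi (repr x) = x.
Proof. exact: reprK. Qed.

Lemma locW (P : loc -> Prop) : (forall p, P (locpi p)) -> forall x, P x.
Proof. by move=> h x; rewrite -(locpi_repr x). Qed.

Lemma lequiv_repr p : lequiv (repr (locpi p)) p.
Proof. by apply/locpiP; rewrite locpi_repr. Qed.

Definition lpair_add p q :=
  Lpair (lnum p * lden q + lnum q * lden p) (mulsetM (ldenP p) (ldenP q)).
Definition lpair_mul p q :=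
  Lpair (lnum p * lnum q) (mulsetM (ldenP p) (ldenP q)).
Definition lpair_opp p := Lpair (- lnum p) (ldenP p).
Definition lpair_const a := Lpair a (mulset1 D).

Definition loc_const a : loc := locpi (lpair_const a).
Definition loc_add (x y : loc) : loc := locpi (lpair_add (repr x) (repr y)).
Definition loc_mul (x y : loc) : loc := locpi (lpair_mul (repr x) (repr y)).
Definition loc_opp (x : loc) : loc := locpi (lpair_opp (repr x)).

Lemma loc_addE p q : loc_add (locpi p) (locpi q) = locpi (lpair_add p q).
Proof.
have /eqP ep := lequiv_repr p; have /eqP eq := lequiv_repr q.
move: ep eq; rewrite /locpi; set p' := repr _; set q' := repr _ => ep eq.
apply/locpiP/eqP; rewrite /lnum /lden /= -!/(lnum _) -!/(lden _).
transitivity ((lnum p' * lden p) * (lden q' * lden q) +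
              (lnum q' * lden q) * (lden p' * lden p)); first by ring.
by rewrite ep eq; ring.
Qed.

Lemma loc_mulE p q : loc_mul (locpi p) (locpi q) = locpi (lpair_mul p q).
Proof.
have /eqP ep := lequiv_repr p; have /eqP eq := lequiv_repr q.
apply/locpiP/eqP; rewrite /lnum /lden /= -!/(lnum _) -!/(lden _).
by rewrite mulrACA ep eq mulrACA.
Qed.

Lemma loc_oppE p : loc_opp (locpi p) = locpi (lpair_opp p).
Proof.
have /eqP ep := lequiv_repr p.
apply/locpiP/eqP; rewrite /lnum /lden /= -!/(lnum _) -!/(lden _).
by rewrite !mulNr ep.
Qed.

Local Ltac loc_eq := apply/locpiP/eqP; rewrite !(lnumE, ldenE).

Lemma loc_addA : associative loc_add.
Proof.
elim/locW => p; elim/locW => q; elim/locW => r; rewrite !loc_addE.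
by loc_eq; ring.
Qed.

Lemma loc_addC : commutative loc_add.
Proof.
elim/locW => p; elim/locW => q; rewrite !loc_addE.
by loc_eq; rewrite addrC [lden q * _]mulrC.
Qed.

Lemma loc_add0 : left_id (loc_const 0) loc_add.
Proof.
elim/locW => p; rewrite loc_addE.
by loc_eq; rewrite mul0r add0r mulr1 mul1r.
Qed.

Lemma loc_addN : left_inverse (loc_const 0) loc_opp loc_add.
Proof.
elim/locW => p; rewrite loc_oppE loc_addE.
by loc_eq; rewrite mulNr addNr !mul0r.
Qed.

HB.instance Definition _ :=
  GRing.isZmodule.Build loc loc_addA loc_addC loc_add0 loc_addN.

Lemma loc_mulA : associative loc_mul.
Proof.
elim/locW => p; elim/locW => q; elim/locW => r; rewrite !loc_mulE.
by loc_eq; rewrite !mulrA.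
Qed.

Lemma loc_mulC : commutative loc_mul.
Proof.
elim/locW => p; elim/locW => q; rewrite !loc_mulE.
by loc_eq; rewrite [lnum p * _]mulrC [lden p * _]mulrC.
Qed.

Lemma loc_mul1 : left_id (loc_const 1) loc_mul.
Proof. by elim/locW => p; rewrite loc_mulE; loc_eq; rewrite !mul1r. Qed.

Lemma loc_mulDl : left_distributive loc_mul loc_add.
Proof.
elim/locW => p; elim/locW => q; elim/locW => r; rewrite !(loc_mulE, loc_addE).
by loc_eq; ring.
Qed.

Lemma loc_one_neq0 : loc_const 1 != 0.
Proof.
apply/eqP => /locpiP/eqP; rewrite /lnum /lden /= mulr1 mul0r => /eqP.
by rewrite oner_eq0.
Qed.

HB.instance Definition _ := GRing.Zmodule_isComNzRing.Build loc
  loc_mulA loc_mulC loc_mul1 loc_mulDl loc_one_neq0.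

Lemma loc_const_is_zmod_morphism : zmod_morphism loc_const.
Proof.
move=> a b; rewrite [RHS](_ : _ = loc_add (loc_const a) (loc_opp (loc_const b))) //.
by rewrite loc_oppE loc_addE; loc_eq; rewrite !mulr1.
Qed.

Lemma loc_const_is_monoid_morphism : monoid_morphism loc_const.
Proof.
split=> // a b; rewrite [RHS](_ : _ = loc_mul (loc_const a) (loc_const b)) //.
by rewrite loc_mulE; loc_eq; rewrite !mulr1.
Qed.

HB.instance Definition _ := GRing.isZmodMorphism.Build R loc loc_const
  loc_const_is_zmod_morphism.
HB.instance Definition _ := GRing.isMonoidMorphism.Build R loc loc_const
  loc_const_is_monoid_morphism.

Definition loc_unit (x : loc) : bool := `[< exists y, y * x = 1 >].

Definition loc_inv (x : loc) : loc :=
  if pselect (exists y, y * x = 1) is left ex then projT1 (cid ex) else x.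

Lemma loc_mulVr : {in loc_unit, left_inverse 1 loc_inv *%R}.
Proof.
move=> x /asboolP ux; rewrite /loc_inv.
by case: pselect => // ex; case: (cid ex).
Qed.

Lemma loc_unitP x y : y * x = 1 -> loc_unit x.
Proof. by move=> e; apply/asboolP; exists y. Qed.

Lemma loc_inv_out : {in [predC loc_unit], loc_inv =1 id}.
Proof.
move=> x; rewrite inE /= => /asboolPn nu; rewrite /loc_inv.
by case: pselect.
Qed.

HB.instance Definition _ := GRing.ComNzRing_hasMulInverse.Build loc
  loc_mulVr loc_unitP loc_inv_out.

Lemma loc_const_unit s : D s -> loc_const s \is a GRing.unit.
Proof.
move=> Ds; apply/unitrPr; exists (locpi (Lpair 1 Ds)).
rewrite [LHS](_ : _ = loc_mul (loc_const s) (locpi (Lpair 1 Ds))) // loc_mulE.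
by rewrite [RHS](_ : _ = locpi (lpair_const 1)) //; loc_eq; rewrite !mulr1 !mul1r.
Qed.

Lemma locpiE p : locpi p = loc_const (lnum p) / loc_const (lden p).
Proof.
apply: (mulIr (loc_const_unit (ldenP p))); rewrite mulrVK ?loc_const_unit //; last first.
  exact: ldenP.
rewrite [LHS](_ : _ = loc_mul (locpi p) (loc_const (lden p))) // loc_mulE.
by loc_eq; rewrite !mulr1.
Qed.

Lemma loc_const_inj : injective loc_const.
Proof. by move=> a b /locpiP/eqP; rewrite /lnum /lden /= !mulr1. Qed.

End Localization.

Lemma regular1 (R : comNzRingType) : regular (1 : R).
Proof. by move=> a; rewrite mulr1. Qed.

Lemma regularM (R : comNzRingType) (s t : R) :
  regular s -> regular t -> regular (s * t).
Proof. by move=> rs rt a; rewrite mulrA => /rt /rs. Qed.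

Lemma regularX (R : comNzRingType) (s : R) k : regular s -> regular (s ^+ k).
Proof.
move=> rs; elim: k => [|k IH]; first exact: regular1.
by rewrite exprS; apply: regularM.
Qed.

Definition regular_mulset (R : comNzRingType) : mulset R :=
  Mulset (@regular1 R) (@regularM R) (fun _ => id).

(* Total ring of fractions; the usual fraction field when R is a domain.
   The library's {fraction R} would require an idomainType structure on R. *)
Definition Frac (R : comNzRingType) := loc (regular_mulset R).
HB.instance Definition _ (R : comNzRingType) := GRing.ComUnitRing.on (Frac R).

Section LaurentPolynomials.

Let powX (p : {poly int}) := exists k, p = 'X^k.

Lemma powX1 : powX 1.
Proof. by exists 0; rewrite expr0. Qed.
Lemma powXM p q : powX p -> powX q -> powX (p * q).
Proof. by move=> [k ->] [l ->]; exists (k + l)%N; rewrite exprD. Qed.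
Lemma powX_regular p : powX p -> regular p.
Proof.
move=> [k ->] a /eqP; rewrite mulf_eq0 expf_eq0 polyX_eq0 andbF orbF.
by move/eqP.
Qed.

(* Z[beta, beta^-1], as the localization of Z[beta] at the powers of beta. *)
Definition laurent := loc (Mulset powX1 powXM powX_regular).
HB.instance Definition _ := GRing.ComUnitRing.on laurent.

Definition lbeta : laurent := loc_const _ 'X.

Lemma lbeta_unit : lbeta \is a GRing.unit.
Proof. by apply: loc_const_unit; exists 1%N. Qed.

End LaurentPolynomials.

(* S[[x_i : i in I]] is the completion of the polynomial ring S[x_i : i in I]
   at the ideal generated by the variables, i.e. the product over k of the
   homogeneous parts of degree k of the polynomial ring. A series is encoded as
   the sequence of its homogeneous components: [fcoef f k] is a polynomial,
   homogeneous of degree k, and the product is the Cauchy product. *)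

Section MultivariatePowerSeries.
Variables (I : choiceType) (S : comNzRingType).

Definition homog (k : nat) (p : {malg S[{cmonom I}]}) : Prop :=
  forall m, p@_m != 0 -> mdeg m = k.

Lemma homog0 k : homog k 0.
Proof. by move=> m; rewrite mcoeff0 eqxx. Qed.

Lemma homogN k p : homog k p -> homog k (- p).
Proof. by move=> hp m; rewrite mcoeffN oppr_eq0; apply: hp. Qed.

Lemma homogD k p q : homog k p -> homog k q -> homog k (p + q).
Proof.
move=> hp hq m; rewrite mcoeffD => h.
have [p0|] := eqVneq p@_m 0; last exact: hp.
by apply: hq; rewrite p0 add0r in h.
Qed.

Lemma homog_sum k (J : Type) (r : seq J) (P : pred J) F :
  (forall j, P j -> homog k (F j)) -> homog k (\sum_(j <- r | P j) F j).
Proof. by move=> h; elim/big_rec: _ => [|j p /h]; [exact: homog0|exact: homogD]. Qed.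

Lemma homogU k m c : mdeg m = k -> homog k << c *g m >>.
Proof. by move=> mk m'; rewrite mcoeffU; case: (m =P m') => [<-|_] /=; rewrite ?mulr0n ?eqxx. Qed.

Lemma homogM k l p q : homog k p -> homog l q -> homog (k + l) (p * q).
Proof.
move=> hp hq; rewrite malgME; apply: homog_sum => a _; apply: homog_sum => b _.
have [->|pa] := eqVneq p@_a 0; first by rewrite mul0r monalgU0; exact: homog0.
have [->|qb] := eqVneq q@_b 0; first by rewrite mulr0 monalgU0; exact: homog0.
by apply: homogU; rewrite mdegM (hp _ pa) (hq _ qb).
Qed.

Lemma homog1 : homog 0 1.
Proof. by apply: homogU; rewrite mdeg1. Qed.

Definition mps_pred (f : fps {malg S[{cmonom I}]}) : bool :=
  `[< forall k, homog k (fcoef f k) >].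

Lemma mps_closed : subring_closed mps_pred.
Proof.
split=> [|f g /asboolP hf /asboolP hg|f g /asboolP hf /asboolP hg].
- by apply/asboolP => -[|k]; [exact: homog1|exact: homog0].
- by apply/asboolP => k; apply: homogD; [|apply: homogN].
- apply/asboolP => k; rewrite fcoefM; apply: homog_sum => i _.
  by rewrite -[k in homog k](subnKC (leq_ord i)); apply: homogM.
Qed.

HB.instance Definition _ := GRing.isSubringClosed.Build _ mps_pred mps_closed.

Record mps := Mps { mps_val :> fps {malg S[{cmonom I}]}; _ : mps_pred mps_val }.
HB.instance Definition _ := [isSub for mps_val].
HB.instance Definition _ := [Choice of mps by <:].
HB.instance Definition _ := [SubChoice_isSubComNzRing of mps by <:].

Definition mps_coef (f : mps) k : {malg S[{cmonom I}]} := fcoef (val f) k.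

Lemma mps_coef_homog f k : homog k (mps_coef f k).
Proof. by move: k; apply/asboolP; apply: (valP f). Qed.

Lemma mpsP (f g : mps) : mps_coef f =1 mps_coef g -> f = g.
Proof. by move=> h; apply/val_inj/fpsP. Qed.

Lemma mps_const_subproof c : mps_pred (fps_const c%:MP).
Proof.
by apply/asboolP => -[|k]; [apply: homogU; rewrite mdeg1|exact: homog0].
Qed.
Definition mps_const (c : S) : mps := Mps (mps_const_subproof c).

Lemma mps_var_subproof i :
  mps_pred (Fps (fun k => if k == 1%N then << ucm i >> else 0)).
Proof.
apply/asboolP => k /=; case: eqP => [->|_]; last exact: homog0.
by apply: homogU; rewrite mdegU.
Qed.
Definition mps_var (i : I) : mps := Mps (mps_var_subproof i).

Definition eq_mod_order k (f g : mps) :=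
  forall j, (j < k)%N -> mps_coef f j = mps_coef g j.

(* Closure for the topology of the completion, in which the series of order >= k
   form a basis of neighbourhoods of 0. *)
Definition closure (P : mps -> Prop) (f : mps) : Prop :=
  forall k, exists2 g, P g & eq_mod_order k f g.

Lemma mps_coefD f g k : mps_coef (f + g) k = mps_coef f k + mps_coef g k.
Proof. by []. Qed.
Lemma mps_coefN f k : mps_coef (- f) k = - mps_coef f k.
Proof. by []. Qed.
Lemma mps_coefM f g k :
  mps_coef (f * g) k = \sum_(i < k.+1) mps_coef f i * mps_coef g (k - i).
Proof. by []. Qed.
Lemma mps_coef1 : mps_coef 1 0 = 1.
Proof. by []. Qed.

End MultivariatePowerSeries.

Arguments mps_const {I S} c.
Arguments mps_var {I S} i.

(* The substitution x_i |-> x_(sigma i). *)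
Section Relabel.
Variables (I : choiceType) (S : comNzRingType) (sigma : I -> I).
Local Notation A := {malg S[{cmonom I}]}.

Definition relabel_monom (m : {cmonom I}) : A :=
  \prod_(i <- finsupp m) << ucm (sigma i) >> ^+ m i.

Lemma relabel_monomEw (d : {fset I}) (m : {cmonom I}) : (finsupp m `<=` d)%fset ->
  relabel_monom m = \prod_(i <- d) << ucm (sigma i) >> ^+ m i.
Proof.
move=> le; apply: big_fset_incl => // i _.
by rewrite -cmE_eq0 => /eqP ->; rewrite expr0.
Qed.

Lemma relabel_monom_morph : mmorphism relabel_monom.
Proof.
split; last by rewrite /relabel_monom mdom1 big_seq_fset0.
move=> m1 m2; pose d := (finsupp m1 `|` finsupp m2)%fset.
rewrite !(@relabel_monomEw d) ?fsubsetUl ?fsubsetUr ?mdomD //.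
by rewrite -big_split; apply: eq_bigr => i _; rewrite cmM exprD.
Qed.

HB.instance Definition _ := isMultiplicative.Build _ _ relabel_monom
  relabel_monom_morph.

Definition relabel (p : A) : A := mmap (@malgC _ S) relabel_monom p.
Lemma relabel_is_zmod_morphism : zmod_morphism relabel.
Proof. exact: mmap_is_additive. Qed.
Lemma relabel_is_monoid_morphism : monoid_morphism relabel.
Proof. by have [h1 h2] := mmap_is_multiplicative (f := @malgC _ S) (h := relabel_monom); split. Qed.
HB.instance Definition _ := GRing.isZmodMorphism.Build A A relabel
  relabel_is_zmod_morphism.
HB.instance Definition _ := GRing.isMonoidMorphism.Build A A relabel
  relabel_is_monoid_morphism.

Lemma relabel_const c : relabel c%:MP = c%:MP.
Proof. by rewrite /relabel mmapC. Qed.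

Lemma relabel_var i : relabel << ucm i >> = << ucm (sigma i) >>.
Proof.
rewrite /relabel mmapU [X in X * _](_ : _ = 1) ?mul1r /relabel_monom ?mdomU //.
by rewrite big_seq_fset1 cmUU expr1.
Qed.

Lemma homog_relabel k p : homog k p -> homog k (relabel p).
Proof.
move=> hp; rewrite /relabel mmapE; apply: homog_sum => m _.
have [->|/hp <-] := eqVneq p@_m 0; first by rewrite malgC0E mul0r; exact: homog0.
rewrite -[mdeg m]add0n; apply: homogM; first by apply: homogU; rewrite mdeg1.
rewrite mdegE /relabel_monom; elim/big_rec2: _ => [|i k' q _ hq]; first exact: homog1.
apply: homogM => //; elim: (m i) => [|e he]; first by rewrite expr0; exact: homog1.
by rewrite exprS -add1n; apply: homogM he; apply: homogU; rewrite mdegU.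
Qed.

Lemma mps_relabel_subproof (f : mps I S) : mps_pred (fps_map relabel f).
Proof. by apply/asboolP => k; apply/homog_relabel/mps_coef_homog. Qed.

Definition mps_relabel (f : mps I S) : mps I S := Mps (mps_relabel_subproof f).

Lemma mps_relabel_is_zmod_morphism : zmod_morphism mps_relabel.
Proof. by move=> f g; apply/val_inj; rewrite /= rmorphB. Qed.
Lemma mps_relabel_is_monoid_morphism : monoid_morphism mps_relabel.
Proof.
by split=> [|f g]; apply/val_inj; rewrite /= ?rmorph1 ?rmorphM.
Qed.
HB.instance Definition _ := GRing.isZmodMorphism.Build _ _ mps_relabel
  mps_relabel_is_zmod_morphism.
HB.instance Definition _ := GRing.isMonoidMorphism.Build _ _ mps_relabel
  mps_relabel_is_monoid_morphism.

Lemma mps_relabel_const c : mps_relabel (mps_const c) = mps_const c.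
Proof.
by apply/mpsP => -[|k]; rewrite /mps_coef /= ?relabel_const ?rmorph0.
Qed.

Lemma mps_relabel_var i : mps_relabel (mps_var i) = mps_var (sigma i).
Proof.
apply/mpsP => k; rewrite /mps_coef /=.
by case: eqP => _; rewrite ?relabel_var ?rmorph0.
Qed.

Lemma mps_relabel_eq_mod k f g :
  eq_mod_order k f g -> eq_mod_order k (mps_relabel f) (mps_relabel g).
Proof. by move=> h j /h; rewrite /mps_coef /= => ->. Qed.

End Relabel.

Section RelabelComposition.
Variables (I : choiceType) (S : comNzRingType).
Local Notation A := {malg S[{cmonom I}]}.

Lemma malgU_mul (m1 m2 : {cmonom I}) : << mmul m1 m2 >> = << m1 >> * << m2 >> :> A.
Proof. by rewrite malgM_def fgmulUU mulr1. Qed.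

Lemma malgU_exp (m : {cmonom I}) e : (<< m >> : A) ^+ e = << iter e (mmul m) mone >>.
Proof.
elim: e => [|e IH]; first by rewrite expr0.
by rewrite exprS {}IH -malgU_mul.
Qed.

Lemma iter_ucmE e (i j : I) : iter e (mmul (ucm i)) mone j = (e * (i == j))%N.
Proof.
elim: e => [|e IH] /=; first by rewrite cm1.
by rewrite cmM IH cmU mulSn.
Qed.

Lemma relabel_monom_id (m : {cmonom I}) : @relabel_monom I S id m = << m >>.
Proof.
rewrite /relabel_monom; under eq_bigr do rewrite malgU_exp.
rewrite -(big_morph (fun m' : {cmonom I} => << m' >> : A) malgU_mul (erefl _)).
congr (<< _ >>); apply/eqP/cmP => j.
rewrite (big_morph (fun m' : {cmonom I} => m' j) (cmM j) (cm1 j)).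
under eq_bigr do rewrite iter_ucmE.
case: (boolP (j \in finsupp m)) => jm.
  rewrite (big_fsetD1 j) //= eqxx muln1 big_seq big1 ?addn0 // => i.
  by rewrite !inE => /andP[/negPf -> _]; rewrite muln0.
rewrite big_seq big1; first by apply/esym/eqP; rewrite cmE_eq0.
by move=> i im; case: eqP => [ij|]; rewrite ?muln0 //; rewrite -ij im in jm.
Qed.

Lemma relabel_id (p : A) : relabel id p = p.
Proof.
rewrite /relabel mmapE [RHS]monalgE; apply: eq_bigr => m _.
by rewrite relabel_monom_id malgM_def fgmulUU mulr1 mul1m.
Qed.

Lemma relabel_comp (s t : I -> I) (p : A) :
  relabel s (relabel t p) = relabel (s \o t) p.
Proof.
rewrite {2}/relabel mmapE rmorph_sum [RHS]mmapE; apply: eq_bigr => m _.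
rewrite rmorphM /= relabel_const rmorph_prod; congr (_ * _).
by apply: eq_bigr => i _; rewrite rmorphXn /= relabel_var.
Qed.

Lemma mps_relabelK (s t : I -> I) :
  cancel s t -> cancel (@mps_relabel I S s) (mps_relabel t).
Proof.
move=> st f; apply/mpsP => k; rewrite /mps_coef /= relabel_comp.
by rewrite (_ : t \o s = id) ?relabel_id //; apply/funext => i /=; rewrite st.
Qed.

End RelabelComposition.

Section GeneratedIdeal.
Variables (R : comNzRingType) (G : R -> Prop).

Definition gen_ideal (f : R) : Prop :=
  exists s : seq (R * R),
    (forall x, x \in s -> G x.2) /\ f = \sum_(x <- s) x.1 * x.2.

Lemma gen_idealD f g : gen_ideal f -> gen_ideal g -> gen_ideal (f + g).
Proof.
move=> [s [hs ->]] [t [ht ->]]; exists (s ++ t); split; last by rewrite big_cat.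
by move=> x; rewrite mem_cat => /orP[/hs|/ht].
Qed.

Lemma gen_ideal0 : gen_ideal 0.
Proof. by exists [::]; rewrite big_nil. Qed.

Lemma gen_idealM a f : gen_ideal f -> gen_ideal (a * f).
Proof.
move=> [s [hs ->]]; exists [seq (a * x.1, x.2) | x <- s]; split.
  by move=> _ /mapP[x xs ->] /=; apply: hs.
by rewrite big_map mulr_sumr; apply: eq_bigr => x _; rewrite mulrA.
Qed.

End GeneratedIdeal.

(* Lambda, with basis y_1, ..., y_n; W acts by w(y_a) = y_(w a), see
   lattice_act_ybasis. *)
Definition lattice (n : nat) := 'rV[int]_n.

Definition ybasis n (a : 'I_n) : lattice n := delta_mx 0 a.

Definition lattice_act n (w : 'S_n) (lam : lattice n) : lattice n :=
  \row_a lam 0 (w^-1%g a).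

Lemma lattice_act_ybasis n (w : 'S_n) a : lattice_act w (ybasis a) = ybasis (w a).
Proof.
apply/rowP => b; rewrite !mxE !eqxx /=.
by congr (_ %:R); congr (nat_of_bool _); apply/eqP/eqP => [<-|->]; rewrite ?permKV ?permK.
Qed.

Lemma lattice_actD n (w : 'S_n) lam mu :
  lattice_act w (lam + mu) = lattice_act w lam + lattice_act w mu.
Proof. by apply/rowP => b; rewrite !mxE. Qed.

Lemma lattice_act0 n (w : 'S_n) : lattice_act w 0 = 0.
Proof. by apply/rowP => b; rewrite !mxE. Qed.

Section FormalGroupAlgebra.
Variables (n : nat) (S : comNzRingType) (beta : S).
Local Notation ps := (mps (lattice n) S).

(* The formal group law F_C. *)
Definition connective_fgl (f g : ps) : ps := f + g - mps_const beta * f * g.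

Lemma mps_relabel_fgl sigma f g : mps_relabel sigma (connective_fgl f g) =
  connective_fgl (mps_relabel sigma f) (mps_relabel sigma g).
Proof.
rewrite /connective_fgl (rmorphB (mps_relabel sigma)) (rmorphD (mps_relabel sigma)) /=.
by rewrite !(rmorphM (mps_relabel sigma)) /= mps_relabel_const.
Qed.

Definition fga_rel (f : ps) : Prop :=
  f = mps_var 0 \/
  exists lam mu : lattice n,
    f = mps_var (lam + mu) - connective_fgl (mps_var lam) (mps_var mu).

Definition fga_ideal (f : ps) : bool := `[< closure (gen_ideal fga_rel) f >].

Lemma fga_rel_coef0 f : fga_rel f -> mps_coef f 0 = 0.
Proof.
case=> [->|[lam [mu ->]]] //.
by rewrite !(mps_coefD, mps_coefN, mps_coefM) big_ord1 mulr0 /= subr0 addr0 subr0.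
Qed.

Lemma gen_ideal_coef0 f : gen_ideal fga_rel f -> mps_coef f 0 = 0.
Proof.
move=> [s [hs ->]]; elim: s hs => [|x s IH] hs; first by rewrite big_nil.
rewrite big_cons mps_coefD IH ?addr0 => [|y ys]; last by apply: hs; rewrite inE ys orbT.
by rewrite mps_coefM big_ord1 subnn (fga_rel_coef0 (hs x _)) ?mulr0 ?mem_head.
Qed.

Lemma fga_ideal_closed : idealr_closed fga_ideal.
Proof.
split.
- by apply/asboolP => k; exists 0 => //; exact: gen_ideal0.
- apply/asboolP => /(_ 1%N)[g /gen_ideal_coef0 g0 /(_ 0 isT)].
  by rewrite g0 mps_coef1 => /eqP; rewrite oner_eq0.
- move=> a f g /asboolP hf /asboolP hg; apply/asboolP => k.
  have [f' If ef] := hf k; have [g' Ig eg] := hg k.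
  exists (a * f' + g'); first by apply: gen_idealD => //; exact: gen_idealM.
  move=> j jk; rewrite (mps_coefD (a * f) g) (mps_coefD (a * f') g') (eg _ jk).
  suff -> : mps_coef (a * f) j = mps_coef (a * f') j by [].
  rewrite (mps_coefM a f) (mps_coefM a f'); apply: eq_bigr => i _.
  by rewrite (ef _ (leq_ltn_trans (leq_subr _ _) jk)).
Qed.

HB.instance Definition _ := isIdealr.Build ps fga_ideal fga_ideal_closed.

(* S[[Lambda]]_{F_C} *)
Definition fga_idealr : idealr ps := fga_ideal.
Definition fga := {ideal_quot fga_idealr}.
HB.instance Definition _ := GRing.ComNzRing.on fga.

Definition fga_pi (f : ps) : fga := \pi f.

Lemma fga_pi_is_zmod_morphism : zmod_morphism fga_pi.
Proof. by move=> f g; rewrite /fga_pi !piE. Qed.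
Lemma fga_pi_is_monoid_morphism : monoid_morphism fga_pi.
Proof. by split=> [|f g]; rewrite /fga_pi !piE. Qed.
HB.instance Definition _ := GRing.isZmodMorphism.Build ps fga fga_pi
  fga_pi_is_zmod_morphism.
HB.instance Definition _ := GRing.isMonoidMorphism.Build ps fga fga_pi
  fga_pi_is_monoid_morphism.

Lemma fga_piP f g : reflect (fga_pi f = fga_pi g) (fga_ideal (f - g)).
Proof.
by apply: (iffP idP) => [h|/eqP]; [apply/eqP|]; rewrite /fga_pi piE.
Qed.

Lemma fga_pi_repr (f : fga) : fga_pi (repr f) = f.
Proof. exact: reprK. Qed.

Definition fga_const (c : S) : fga := fga_pi (mps_const c).
Definition fga_var (lam : lattice n) : fga := fga_pi (mps_var lam).

(* The action w(x_lam) = x_(w lam), induced from the power series ring. *)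
Definition fga_act (w : 'S_n) (f : fga) : fga :=
  fga_pi (mps_relabel (lattice_act w) (repr f)).

Lemma fga_ideal_relabel w f :
  fga_ideal f -> fga_ideal (mps_relabel (lattice_act w) f).
Proof.
move=> /asboolP h; apply/asboolP => k; have [g [s [hs ->]] e] := h k.
exists (mps_relabel (lattice_act w) (\sum_(x <- s) x.1 * x.2)); last exact: mps_relabel_eq_mod.
exists [seq (mps_relabel (lattice_act w) x.1, mps_relabel (lattice_act w) x.2) | x <- s].
split; last by rewrite big_map rmorph_sum; apply: eq_bigr => x _; rewrite rmorphM.
move=> _ /mapP[x /hs + ->]; case=> [->|[lam [mu ->]]].
  by left; rewrite mps_relabel_var lattice_act0.
right; exists (lattice_act w lam), (lattice_act w mu).
by rewrite rmorphB /= mps_relabel_fgl !mps_relabel_var lattice_actD.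
Qed.

Lemma fga_act_pi w f : fga_act w (fga_pi f) = fga_pi (mps_relabel (lattice_act w) f).
Proof.
apply/fga_piP; rewrite -rmorphB; apply: fga_ideal_relabel.
by apply/fga_piP; rewrite fga_pi_repr.
Qed.

Lemma fga_act_var w lam : fga_act w (fga_var lam) = fga_var (lattice_act w lam).
Proof. by rewrite /fga_var fga_act_pi mps_relabel_var. Qed.

Lemma fga_act_const w c : fga_act w (fga_const c) = fga_const c.
Proof. by rewrite /fga_const fga_act_pi mps_relabel_const. Qed.

Lemma fga_act_is_zmod_morphism w : zmod_morphism (fga_act w).
Proof.
move=> f g; rewrite -(fga_pi_repr f) -(fga_pi_repr g).
by rewrite -rmorphB !fga_act_pi !rmorphB.
Qed.
Lemma fga_act_is_monoid_morphism w : monoid_morphism (fga_act w).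
Proof.
split=> [|f g]; first by rewrite -(rmorph1 fga_pi) fga_act_pi !rmorph1.
rewrite -(fga_pi_repr f) -(fga_pi_repr g).
by rewrite -rmorphM !fga_act_pi !rmorphM.
Qed.
HB.instance Definition _ w := GRing.isZmodMorphism.Build fga fga (fga_act w)
  (fga_act_is_zmod_morphism w).
HB.instance Definition _ w := GRing.isMonoidMorphism.Build fga fga (fga_act w)
  (fga_act_is_monoid_morphism w).

Lemma fga_var0 : fga_var 0 = 0.
Proof.
rewrite -(rmorph0 fga_pi); apply/fga_piP; rewrite subr0; apply/asboolP => k.
exists (mps_var 0) => //; exists [:: (1, mps_var 0)]; split; last by rewrite big_seq1 mul1r.
by move=> x; rewrite inE => /eqP ->; left.
Qed.

Lemma fga_varD lam mu : fga_var (lam + mu) =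
  fga_var lam + fga_var mu - fga_const beta * fga_var lam * fga_var mu.
Proof.
rewrite -!rmorphM -!rmorphD -rmorphB; apply/fga_piP/asboolP => k.
set g := _ - _; exists g => //; exists [:: (1, g)]; split; last by rewrite big_seq1 mul1r.
by move=> x; rewrite inE => /eqP ->; right; exists lam, mu.
Qed.

Lemma fga_actK w : cancel (fga_act w) (fga_act w^-1).
Proof.
move=> f; rewrite -{1}(fga_pi_repr f) !fga_act_pi mps_relabelK ?fga_pi_repr //.
by move=> lam; apply/rowP => a; rewrite !mxE invgK permK.
Qed.

End FormalGroupAlgebra.

Arguments fga_var n {S} beta lam.

Section SymmetricGroup.
Variable n : nat.
Local Open Scope group_scope.

Lemma simple_index_ltn (i : 'I_n.-1) : (i.+1 < n)%N.
Proof. by case: n i => [|m] i; [case: i|exact: (ltn_ord i)]. Qed.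

(* The index i : 'I_n.-1 stands for the pair of adjacent positions i, i + 1. *)
Definition adj_l (i : 'I_n.-1) : 'I_n := Ordinal (ltnW (simple_index_ltn i)).
Definition adj_r (i : 'I_n.-1) : 'I_n := Ordinal (simple_index_ltn i).

Definition simple_refl (i : 'I_n.-1) : 'S_n := tperm (adj_l i) (adj_r i).

Definition root (p : 'I_n * 'I_n) : lattice n := (ybasis p.1 - ybasis p.2)%R.
Definition simple_root (i : 'I_n.-1) : lattice n := root (adj_l i, adj_r i).

Definition inversions (w : 'S_n) : {set 'I_n * 'I_n} :=
  [set p : 'I_n * 'I_n | (p.1 < p.2)%N && (w p.2 < w p.1)%N].

Definition perm_length (w : 'S_n) : nat := #|inversions w|.

(* The product of {perm _} is in diagrammatic order, (s * t) x = t (s x), so that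
   the word [:: i1; ..; ik] stands for the composite of functions
   r_i1 o ... o r_ik. *)
Definition word_perm (s : seq 'I_n.-1) : 'S_n :=
  foldr (fun i w => w * simple_refl i) 1 s.

Lemma word_perm_rcons s i : word_perm (rcons s i) = simple_refl i * word_perm s.
Proof.
elim: s => [|j s IH] /=; first by rewrite mul1g mulg1.
by rewrite IH mulgA.
Qed.

Lemma simple_reflE (i : 'I_n.-1) (a : 'I_n) : simple_refl i a =
  (if a == i :> nat then i.+1 else if a == i.+1 :> nat then i : nat else a) :> nat.
Proof.
rewrite /simple_refl; case: tpermP => [->|->|nl nr] /=; first by rewrite eqxx.
  by rewrite eqxx; case: eqP => //; lia.
by case: eqP => [e|_]; [case: nl; apply: val_inj|case: eqP => [e|//]; case: nr; apply: val_inj].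
Qed.

Lemma simple_refl_lt (i : 'I_n.-1) (a b : 'I_n) :
  (a < b)%N -> (a, b) != (adj_l i, adj_r i) ->
  (simple_refl i a < simple_refl i b)%N.
Proof.
move=> ab ne; have {}ne : ~ (a = i :> nat /\ b = i.+1 :> nat).
  case=> ea eb; case/eqP: ne.
  by congr (_, _); apply: val_inj; rewrite /= ?ea ?eb.
by rewrite !simple_reflE; do !case: eqP => ?; lia.
Qed.

Lemma perm_length_descent (w : 'S_n) (i : 'I_n.-1) :
  (w (adj_r i) < w (adj_l i))%N ->
  perm_length w = (perm_length (simple_refl i * w)).+1.
Proof.
move=> desc; set ab := (adj_l i, adj_r i).
have abI : ab \in inversions w by rewrite inE /= ltnS leqnn.
pose phi (p : 'I_n * 'I_n) := (simple_refl i p.1, simple_refl i p.2).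
have phiK : involutive phi by case=> a b; rewrite /phi /= !tpermK.
rewrite /perm_length (cardsD1 ab) abI add1n; congr _.+1.
rewrite -(card_imset _ (inv_inj phiK)); apply: eq_card => p.
rewrite -[p]phiK mem_imset; last exact: inv_inj phiK.
move: (phi p) => {p} [a b]; rewrite !inE /= !permM !tpermK.
have [e|ne] := eqVneq (a, b) ab.
  have [-> ->] : a = adj_l i /\ b = adj_r i by case: e.
  by rewrite /simple_refl tpermL tpermR /= ltnNge leqnSn.
rewrite /=; case: (ltngtP (w b) (w a)) => hw; rewrite ?andbF // !andbT.
apply/idP/idP => [h|h]; first exact: simple_refl_lt.
rewrite -[a](tpermK (adj_l i) (adj_r i)) -[b](tpermK (adj_l i) (adj_r i)).
apply: simple_refl_lt => //; apply/eqP => -[ea eb].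
have ea' : a = adj_r i by rewrite -[a](tpermK (adj_l i) (adj_r i)) ea tpermL.
have eb' : b = adj_l i by rewrite -[b](tpermK (adj_l i) (adj_r i)) eb tpermR.
by move: hw; rewrite ea' eb' ltnNge (ltnW desc).
Qed.

Lemma increasing_perm_ge (w : 'S_n) :
  (forall a b : 'I_n, (a < b)%N -> (w a < w b)%N) -> forall a : 'I_n, (a <= w a)%N.
Proof.
move=> incr [k]; elim: k => [//|k IH] lt.
by apply: leq_ltn_trans (IH (ltnW lt)) _; apply: incr.
Qed.

Lemma perm_length0 (w : 'S_n) : perm_length w = 0%N -> w = 1.
Proof.
move=> /cards0_eq e0.
have incr (a b : 'I_n) : (a < b)%N -> (w a < w b)%N.
  move=> ab; rewrite ltn_neqAle (inj_eq val_inj) (inj_eq perm_inj) -(inj_eq val_inj).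
  rewrite (ltn_eqF ab) /= leqNgt.
  by have := in_set0 (a, b); rewrite -e0 inE /= ab => /= ->.
have incrV (a b : 'I_n) : (a < b)%N -> (w^-1 a < w^-1 b)%N.
  move=> ab; rewrite ltnNge; apply/negP; rewrite leq_eqVlt.
  case/orP => [/eqP/val_inj/perm_inj e|/incr]; first by rewrite e ltnn in ab.
  by rewrite !permKV ltnNge ltnW.
apply/permP => a; rewrite perm1; apply/val_inj/eqP.
rewrite eqn_leq (increasing_perm_ge incr) andbT.
by have := increasing_perm_ge incrV (w a); rewrite permK.
Qed.

Lemma perm_descent (w : 'S_n) : perm_length w != 0%N ->
  exists i : 'I_n.-1, (w (adj_r i) < w (adj_l i))%N.
Proof.
rewrite cards_eq0 => /set0Pn[[a b]]; rewrite inE /= => /andP[ab].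
apply: contraPP => /forallNP nd; apply/negP; rewrite -leqNgt.
have [k bk] : exists k, nat_of_ord b = (a + k)%N by exists (b - a)%N; lia.
elim: k b bk {ab} => [|k IH] b bk.
  by rewrite (_ : a = b) //; apply: val_inj; rewrite /= bk addn0.
have ltk : (a + k < n.-1)%N by have := ltn_ord b; lia.
have := nd (Ordinal ltk) => /negP; rewrite -leqNgt.
have -> : adj_r (Ordinal ltk) = b by apply: val_inj; rewrite /= bk addnS.
by apply: leq_trans; apply: IH.
Qed.

Lemma reduced_word_exists (w : 'S_n) :
  exists s : (perm_length w).-tuple 'I_n.-1, word_perm s == w.
Proof.
suff H k : perm_length w = k -> exists s : k.-tuple 'I_n.-1, word_perm s == w.
  exact: H.
elim: k w => [|k IH] w ek; first by exists [tuple]; rewrite (perm_length0 ek).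
have [|i di] := @perm_descent w; first by rewrite ek.
have [|s /eqP es] := IH (simple_refl i * w).
  by apply: succn_inj; rewrite -perm_length_descent.
exists [tuple of rcons s i]; rewrite word_perm_rcons es mulgA.
by rewrite tperm2 mul1g.
Qed.

Definition reduced_word (w : 'S_n) : seq 'I_n.-1 :=
  tval (xchoose (reduced_word_exists w)).

Lemma reduced_wordP w : word_perm (reduced_word w) = w.
Proof. exact/eqP/(xchooseP (reduced_word_exists w)). Qed.

Lemma size_reduced_word w : size (reduced_word w) = perm_length w.
Proof. exact: size_tuple. Qed.

End SymmetricGroup.

(* The dimensions 0 = i_0 < i_1 < ... < i_d < i_{d+1} = n; values beyond d + 1
   are irrelevant. *)
Record flag (n d : nat) := Flag {
  fdim :> nat -> nat;
  fdim_0 : fdim 0 = 0%N;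
  fdim_n : fdim d.+1 = n;
  fdim_lt : forall j, (j <= d)%N -> (fdim j < fdim j.+1)%N }.

Section Words.
Variables (n d : nat) (fl : flag n d).

(* fstep j is p_j. *)
Definition fstep (j : nat) : nat := (fl j - fl j.-1)%N.

Definition word := n.-tuple 'I_d.+1.

(* With j = j' + 1 and j' : 'I_d.+1, the letter d + 1 - j is rev_ord j'. *)
Definition Gamma_pred (lam : word) : bool :=
  [forall j' : 'I_d.+1, count_mem (rev_ord j') lam == fstep j'.+1].

Definition Gamma := {lam : word | Gamma_pred lam}.

Definition word_act (w : 'S_n) (lam : word) : word :=
  [tuple tnth lam (w^-1%g k) | k < n].

Lemma word_act_perm (w : 'S_n) lam k : tnth (word_act w lam) (w k) = tnth lam k.
Proof. by rewrite tnth_mktuple permK. Qed.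

Lemma Gamma_act_subproof w (lam : Gamma) : Gamma_pred (word_act w (val lam)).
Proof.
apply/forallP => j; have /forallP/(_ j)/eqP <- := valP lam; apply/eqP.
apply/seq.permP; apply/tuple_permP; exists w^-1%g => /=.
by congr (tval _); apply: eq_from_tnth => k; rewrite !tnth_mktuple.
Qed.

Definition Gamma_act (w : 'S_n) (lam : Gamma) : Gamma :=
  exist _ (word_act w (val lam)) (Gamma_act_subproof w lam).

(* d^{p_1} (d-1)^{p_2} ... 0^{p_{d+1}} *)
Definition w0_seq : seq 'I_d.+1 :=
  flatten [seq nseq (fstep j'.+1) (rev_ord j') | j' : 'I_d.+1 <- enum 'I_d.+1].

Lemma w0_size : size w0_seq == n.
Proof.
rewrite size_flatten /shape -map_comp sumnE big_map /=.
under eq_bigr do rewrite size_nseq /fstep /=.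
rewrite big_enum /= -(big_mkord xpredT (fun j => fl j.+1 - fl j)%N).
rewrite telescope_sumn_in // ?fdim_n ?fdim_0 ?subn0 // => j /andP[_ jd].
exact/ltnW/fdim_lt.
Qed.

Lemma w0_Gamma : Gamma_pred (Tuple w0_size).
Proof.
apply/forallP => j; rewrite /= count_flatten -map_comp sumnE big_map big_enum /=.
rewrite (bigD1 j) //= count_nseq /= eqxx mul1n big1 ?addn0 // => k kj.
by rewrite count_nseq /= (inj_eq rev_ord_inj) (negPf kj).
Qed.

Definition w0 : Gamma := exist _ (Tuple w0_size) w0_Gamma.

Definition ell (lam : Gamma) : nat :=
  #|[set p : 'I_n * 'I_n |
      (p.1 < p.2)%N && (tnth (val lam) p.2 < tnth (val lam) p.1)%N]|.

(* See wpermP. *)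
Definition wperm (lam : Gamma) : 'S_n :=
  [arg min_(w < 1%g | Gamma_act w w0 == lam) perm_length w]%N.

Lemma Gamma_act_trans (lam : Gamma) : exists w, Gamma_act w w0 == lam.
Proof.
have /tuple_permP[w e] : perm_eq (val lam) (val w0).
  apply/allP => c _ /=; have /forallP/(_ (rev_ord c)) := valP lam.
  have /forallP/(_ (rev_ord c)) := valP w0.
  by rewrite rev_ordK => /eqP e0 /eqP ->; rewrite -e0.
exists w^-1%g; apply/eqP/val_inj; rewrite [RHS](val_inj e) /=.
by apply: eq_from_tnth => k; rewrite !tnth_mktuple invgK.
Qed.

Lemma wpermP (lam : Gamma) : Gamma_act (wperm lam) w0 = lam /\
  forall w, Gamma_act w w0 = lam -> (perm_length (wperm lam) <= perm_length w)%N.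
Proof.
rewrite /wperm /arg_min /extremum.
case: pickP => [w /andP[/eqP e /forall_inP h]|] /=.
  by split=> // v /eqP; apply: h.
have [w hw] := Gamma_act_trans lam.
have [v hv minv] := @arg_minnP _ w (fun v => Gamma_act v w0 == lam) (@perm_length n) hw.
by move=> /(_ v) /andP[]; split=> //; apply/forall_inP => u; apply: minv.
Qed.

(* Sigma_Theta^+, as the set of pairs (i, j) with y_i - y_j in it. Positions are
   numbered from 0 here, whence the successors. *)
Definition SigmaTheta : {set 'I_n * 'I_n} :=
  [set p : 'I_n * 'I_n | (p.1 < p.2)%N &&
    [exists m : 'I_d, (p.1.+1 <= fl m.+1)%N && (fl m.+1 < p.2.+1)%N]].

End Words.

(* [segre_ring] is Frac (S[[Lambda]]_{F_C}[[x_q]]). When S is a domain,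
   S[[Lambda]]_{F_C} is isomorphic to a power series ring in n variables over S,
   hence a domain; the elements divided by below are then non-zero, so that the
   inverses are genuine ones. *)

Section SegreClasses.
Variables (n d : nat) (fl : flag n d) (S : comNzRingType) (beta : S).

Definition fga_q := fps (fga n beta).
HB.instance Definition _ := GRing.ComNzRing.on fga_q.

Definition segre_ring := Frac fga_q.
HB.instance Definition _ := GRing.ComUnitRing.on segre_ring.

Definition of_fga_q (f : fga_q) : segre_ring := loc_const (regular_mulset fga_q) f.
HB.instance Definition _ := GRing.isZmodMorphism.Build fga_q segre_ring of_fga_q
  (loc_const_is_zmod_morphism (regular_mulset fga_q)).
HB.instance Definition _ := GRing.isMonoidMorphism.Build fga_q segre_ring of_fga_q
  (loc_const_is_monoid_morphism (regular_mulset fga_q)).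

Definition xvar (lam : lattice n) : segre_ring :=
  of_fga_q (fps_const (fga_var n beta lam)).
Definition xq : segre_ring := of_fga_q (fps_var _).
Definition betaK : segre_ring := of_fga_q (fps_const (fga_const n beta beta)).

Definition fga_q_act (w : 'S_n) : fga_q -> fga_q := fps_map (fga_act w).
HB.instance Definition _ w := GRing.isZmodMorphism.Build fga_q fga_q (fga_q_act w)
  (fps_map_is_zmod_morphism (fga_act w)).
HB.instance Definition _ w := GRing.isMonoidMorphism.Build fga_q fga_q (fga_q_act w)
  (fps_map_is_monoid_morphism (fga_act w)).

Definition segre_act (w : 'S_n) (x : segre_ring) : segre_ring :=
  of_fga_q (fga_q_act w (lnum (repr x))) / of_fga_q (fga_q_act w (lden (repr x))).

Lemma fga_q_actK w : cancel (fga_q_act w) (fga_q_act w^-1%g).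
Proof. by move=> f; apply: fpsP => k /=; rewrite fga_actK. Qed.

Lemma regular_act w s : regular s -> regular (fga_q_act w s).
Proof.
move=> rs a e; have := congr1 (fga_q_act w^-1%g) e.
rewrite (rmorphM (fga_q_act w^-1%g)) rmorph0 /= fga_q_actK => /rs e'.
have := fga_q_actK w^-1%g a; rewrite invgK e' => <-.
exact: rmorph0.
Qed.

Lemma of_fga_q_unit s : regular s -> of_fga_q s \is a GRing.unit.
Proof. by move=> rs; apply: loc_const_unit. Qed.

Lemma segre_act_frac w a s : regular s ->
  segre_act w (of_fga_q a / of_fga_q s) =
  of_fga_q (fga_q_act w a) / of_fga_q (fga_q_act w s).
Proof.
move=> rs; set p := @Lpair _ (regular_mulset fga_q) a s rs.
rewrite [X in segre_act w X](_ : _ = locpi p); last exact/esym/locpiE.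
have /eqP := lequiv_repr p; rewrite !(lnumE, ldenE) /segre_act.
set q := repr _ => eq; have rq : regular (lden q) := ldenP q.
have ua := of_fga_q_unit (@regular_act w _ rq).
have ub := of_fga_q_unit (@regular_act w _ rs).
apply: (mulIr ua); rewrite divrK //; apply: (mulIr ub).
rewrite mulrAC divrK // -!(rmorphM of_fga_q) -!(rmorphM (fga_q_act w)).
by congr (of_fga_q (fga_q_act w _)).
Qed.

Lemma segre_act_of w a : segre_act w (of_fga_q a) = of_fga_q (fga_q_act w a).
Proof.
rewrite -[of_fga_q a]divr1 -(rmorph1 of_fga_q) segre_act_frac; last exact: regular1.
by rewrite (rmorph1 (fga_q_act w)) rmorph1 divr1.
Qed.

Lemma segre_act_xvar w lam : segre_act w (xvar lam) = xvar (lattice_act w lam).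
Proof.
rewrite segre_act_of; congr of_fga_q.
by apply: fpsP => -[|k] /=; rewrite ?fga_act_var ?rmorph0.
Qed.

Lemma segre_act_xq w : segre_act w xq = xq.
Proof.
rewrite segre_act_of; congr of_fga_q.
by apply: fpsP => k /=; rewrite rmorph_nat.
Qed.

(* Elements of the direct sum over mu in Gamma; [f mu] is f|_mu. *)
Definition localized := {ffun Gamma fl -> segre_ring}.

Definition apply_word (op : 'I_n.-1 -> localized -> localized) (s : seq 'I_n.-1)
  (f : localized) : localized := foldr op f s.

Definition partial_op (i : 'I_n.-1) (f : localized) : localized :=
  [ffun mu =>
    (1 - xq ^+ 2) *
      (f mu / xvar (- simple_root i) +
       segre_act (simple_refl i) (f (Gamma_act (simple_refl i) mu)) /
         xvar (simple_root i)) +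
    xq ^+ 2 * segre_act (simple_refl i) (f (Gamma_act (simple_refl i) mu))].

Definition conn_segre_w0 : localized :=
  [ffun mu => if mu == w0 fl then
     \prod_(p in SigmaTheta fl)
        (xvar (- root p) / (1 - xq ^+ 2 * (1 - xvar (- root p))))
   else 0].

(* Independent of the reduced word, by the braid relations. *)
Definition conn_segre (lam : Gamma fl) : localized :=
  apply_word partial_op (reduced_word (wperm lam)) conn_segre_w0.

(* e^lam := 1 - beta x_lam, and q := x_q *)
Definition eK (lam : lattice n) : segre_ring := 1 - betaK * xvar lam.

Definition delta_op (i : 'I_n.-1) (f : localized) : localized :=
  [ffun mu =>
    (1 - xq ^+ 2) / (1 - eK (- simple_root i)) * f mu +
    (1 - xq ^+ 2 * eK (simple_root i)) / (1 - eK (simple_root i)) *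
      segre_act (simple_refl i) (f (Gamma_act (simple_refl i) mu))].

Definition mot_segre_w0 : localized :=
  [ffun mu => if mu == w0 fl then
     \prod_(p in SigmaTheta fl)
        ((1 - eK (- root p)) / (1 - xq ^+ 2 * eK (- root p)))
   else 0].

Definition mot_segre (lam : Gamma fl) : localized :=
  apply_word delta_op (reduced_word (wperm lam)) mot_segre_w0.

Definition beta_homogenization (lam : Gamma fl) : localized :=
  [ffun mu => betaK ^- ell lam * mot_segre lam mu].

End SegreClasses.

(* Main.v *)
Require Import Defs.
From HB Require Import structures.
From mathcomp Require Import all_boot all_order all_algebra all_fingroup.
From mathcomp Require Import finmap boolp monalg.
From mathcomp Require Import ring zify.

(** The equality already fails at w = w0, the word for which both classes are
    explicit products supported at the single fixed point w0: the minimal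
    permutation taking w0 to itself is the identity, so no operator is applied.

    Write x_a for x_(-a), with a running over the N elements of Sigma_Theta^+,
    and L for ell(w0). Since 1 - e^(-a) = beta x_a, equality at w0 reads
      prod_a x_a / (1 - q^2 (1 - x_a))
        = beta^(N - L) prod_a x_a / (1 - q^2 (1 - beta x_a)).
    Both denominators have constant term 1 in q, so they may be cleared, and the
    coefficients of q^0 and q^2 give, with Pi = prod_a x_a and Sg = sum_a x_a,
      beta^L Pi = beta^N Pi   and   beta^(L+1) Pi Sg = beta^N Pi Sg
    in the formal group algebra ([longest_class_compare]). If Pi Sg is not killed
    by the differences of powers of beta, then L = N and L + 1 = N, absurd.

    To see that it is not killed, map the formal group algebra to one-variable
    power series in t by
      x_lam |-> (1 - (1 - beta t)^phi(lam)) / beta,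
    where phi is the linear form with phi(y_a) = a. The map respects F_C because
    1 - beta F_C(x, y) = (1 - beta x)(1 - beta y), and the image of x_lam starts
    with phi(lam) t. As phi(-a) > 0 for every positive root a, the image of
    c Pi Sg has lowest coefficient c times a positive integer
    ([fga_prod_sum_roots_torsion]), and no positive multiple of a difference of
    two distinct powers of beta vanishes ([lbeta_expr_inj]). *)

Set Implicit Arguments.
Unset Strict Implicit.
Unset Printing Implicit Defensive.

Import GRing.Theory.
Local Open Scope ring_scope.

(** * One-variable power series *)

Section FpsConst.
Variable A : comNzRingType.
Implicit Types f g : fps A.

Lemma fcoef_sum (J : Type) (r : seq J) (P : pred J) (F : J -> fps A) k :
  fcoef (\sum_(j <- r | P j) F j) k = \sum_(j <- r | P j) fcoef (F j) k.
Proof. by elim/big_rec2: _ => // j a b _ <-. Qed.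

Lemma fcoef_constM a f k : fcoef (fps_const a * f) k = a * fcoef f k.
Proof.
rewrite fcoefM big_ord_recl /= subn0 big1 ?addr0 // => i _.
by rewrite mul0r.
Qed.

Lemma fps_const_is_zmod_morphism : zmod_morphism (@fps_const A).
Proof. by move=> a b; apply: fpsP => -[|k] //=; rewrite subr0. Qed.

Lemma fps_const_is_monoid_morphism : monoid_morphism (@fps_const A).
Proof.
split=> // a b; apply: fpsP => k; rewrite fcoef_constM /=.
by case: k => [|k]; rewrite ?mulr0.
Qed.

HB.instance Definition _ := GRing.isZmodMorphism.Build A (fps A) (@fps_const A)
  fps_const_is_zmod_morphism.
HB.instance Definition _ := GRing.isMonoidMorphism.Build A (fps A) (@fps_const A)
  fps_const_is_monoid_morphism.

Lemma fcoefM0 f g : fcoef (f * g) 0 = fcoef f 0 * fcoef g 0.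
Proof. by rewrite fcoefM big_ord1. Qed.

Lemma fcoef_X2M0 f : fcoef (fps_var A ^+ 2 * f) 0 = 0.
Proof. by rewrite fcoefM0 expr2 fcoefM0 /= mul0r mul0r. Qed.

Lemma fcoef_X2M2 f : fcoef (fps_var A ^+ 2 * f) 2 = fcoef f 0.
Proof.
by rewrite fcoefM expr2 !(big_ord_recl, big_ord0) !fcoefM
  !(big_ord_recl, big_ord0) /= !(mul0r, mulr0, addr0, add0r, mul1r).
Qed.

(** The two coefficients in q = x_q that tell the two kinds of classes apart. *)
Lemma fcoef_prod_X2 (J : Type) (r : seq J) (P : pred J) (c : J -> A) :
  let f := \prod_(j <- r | P j) (1 - fps_var A ^+ 2 * fps_const (c j)) in
  fcoef f 0 = 1 /\ fcoef f 2 = - \sum_(j <- r | P j) c j.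
Proof.
apply: (big_rec2 (fun f s => fcoef f 0 = 1 /\ fcoef f 2 = - s)).
  by split; rewrite ?oppr0.
move=> j f s _ [f0 f2].
rewrite mulrBl mul1r -mulrA !fcoefB fcoef_X2M0 fcoef_X2M2 fcoef_constM.
by rewrite f0 f2 !subr0 mulr1; split=> //; rewrite opprD addrC.
Qed.

(** Such a series is in fact invertible; regularity is what makes its image in
    the total ring of fractions a unit. *)
Lemma regular_fcoef0 f : fcoef f 0 = 1 -> regular f.
Proof.
move=> f0 a af; apply: fpsP => k; elim/ltn_ind: k => k IH.
have := congr1 (fun g => fcoef g k) af.
rewrite fcoefM big_ord_recr /= subnn f0 mulr1 big1 ?add0r // => i _.
by rewrite IH ?ltn_ord ?mul0r.
Qed.

Definition order_ge k f := forall j, (j < k)%N -> fcoef f j = 0.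

Lemma fcoefM_order k l f g : order_ge k f -> order_ge l g ->
  fcoef (f * g) (k + l)%N = fcoef f k * fcoef g l.
Proof.
move=> hf hg; rewrite fcoefM.
have kl : (k < (k + l).+1)%N by rewrite ltnS leq_addr.
rewrite (bigD1 (Ordinal kl)) //= addKn big1 ?addr0 // => i.
rewrite -val_eqE /= neq_ltn => /orP[ik|ki]; first by rewrite hf ?mul0r.
by rewrite hg ?mulr0 //; have := ltn_ord i; lia.
Qed.

Lemma order_geM k l f g : order_ge k f -> order_ge l g -> order_ge (k + l)%N (f * g).
Proof.
move=> hf hg j jkl; rewrite fcoefM big1 // => i _.
have [ik|ki] := ltnP i k; first by rewrite hf ?mul0r.
by rewrite hg ?mulr0 //; have := ltn_ord i; lia.
Qed.

Lemma order_ge_sum k (J : Type) (r : seq J) (P : pred J) F :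
  (forall j, P j -> order_ge k (F j)) -> order_ge k (\sum_(j <- r | P j) F j).
Proof. by move=> hF i ik; rewrite fcoef_sum big1 // => j /hF ->. Qed.

Lemma order_geX k f : order_ge 1 f -> order_ge k (f ^+ k).
Proof.
by move=> hf; elim: k => [|k IH]; [|rewrite exprS -add1n; apply: order_geM].
Qed.

(** The lowest coefficient is multiplicative; both facts are proved by one
    induction because the second needs the first. *)
Lemma order_ge_prod (J : Type) (r : seq J) (F : J -> fps A) :
  (forall j, order_ge 1 (F j)) ->
  order_ge (size r) (\prod_(j <- r) F j) /\
  fcoef (\prod_(j <- r) F j) (size r) = \prod_(j <- r) fcoef (F j) 1.
Proof.
move=> hF; elim: r => [|j r [IH1 IH2]]; first by rewrite !big_nil; split.
rewrite !big_cons [size _]/= -[(size r).+1]add1n; split; first exact: order_geM.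
by rewrite (fcoefM_order (hF j) IH1) IH2.
Qed.

End FpsConst.

(** * Evaluating multivariate power series *)

Section SeriesEvaluation.
Variables (I : choiceType) (S : comNzRingType) (G : I -> fps S).
Hypothesis G0 : forall i, order_ge 1 (G i).

Definition monom_eval (m : {cmonom I}) : fps S :=
  \prod_(i <- finsupp m) G i ^+ m i.

Lemma monom_evalEw (d : {fset I}) (m : {cmonom I}) : (finsupp m `<=` d)%fset ->
  monom_eval m = \prod_(i <- d) G i ^+ m i.
Proof.
move=> le; apply: big_fset_incl => // i _.
by rewrite -cmE_eq0 => /eqP ->; rewrite expr0.
Qed.

Lemma monom_eval_morph : mmorphism monom_eval.
Proof.
split; last by rewrite /monom_eval mdom1 big_seq_fset0.
move=> m1 m2; pose d := (finsupp m1 `|` finsupp m2)%fset.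
rewrite !(@monom_evalEw d) ?fsubsetUl ?fsubsetUr ?mdomD //.
by rewrite -big_split; apply: eq_bigr => i _; rewrite cmM exprD.
Qed.

HB.instance Definition _ := isMultiplicative.Build _ _ monom_eval monom_eval_morph.

Lemma order_monom_eval m : order_ge (mdeg m) (monom_eval m).
Proof.
rewrite mdegE /monom_eval; elim/big_rec2: _ => [//|i f k _ hk].
by apply: order_geM => //; apply: order_geX.
Qed.

Definition malg_eval : {malg S[{cmonom I}]} -> fps S :=
  mmap (@fps_const S) monom_eval.

Lemma malg_eval_is_zmod_morphism : zmod_morphism malg_eval.
Proof. exact: mmap_is_additive. Qed.
Lemma malg_eval_is_monoid_morphism : monoid_morphism malg_eval.
Proof.
by have [h1 h2] := mmap_is_multiplicative (f := @fps_const S) (h := monom_eval); split.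
Qed.
HB.instance Definition _ := GRing.isZmodMorphism.Build _ _ malg_eval
  malg_eval_is_zmod_morphism.
HB.instance Definition _ := GRing.isMonoidMorphism.Build _ _ malg_eval
  malg_eval_is_monoid_morphism.

Lemma order_malg_eval k p : homog k p -> order_ge k (malg_eval p).
Proof.
move=> hp; rewrite /malg_eval mmapE; apply: order_ge_sum => m _ j jk.
rewrite fcoef_constM.
have [->|/hp mk] := eqVneq p@_m 0; first by rewrite mul0r.
by rewrite order_monom_eval ?mulr0 // mk.
Qed.

(** Substitution of G i for the variables. The homogeneous part of degree k is
    sent to a series of order at least k, so only the parts of degree at most j
    contribute to the coefficient of index j and the infinite sum over k is
    meaningful. *)
Definition mps_eval (f : mps I S) : fps S :=
  Fps (fun j => \sum_(k < j.+1) fcoef (malg_eval (mps_coef f k)) j).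

Lemma mps_eval_is_zmod_morphism : zmod_morphism mps_eval.
Proof.
move=> f g; apply: fpsP => j; rewrite fcoefB /= -sumrB; apply: eq_bigr => k _.
by rewrite (mps_coefD f) mps_coefN rmorphB fcoefB.
Qed.

(** The parts of degree greater than j have images of order greater than j, so
    any cutoff above j gives the same coefficient; one cutoff common to several
    series lets their sums be compared termwise. *)
Lemma fcoef_mps_eval N f j : (j < N)%N ->
  fcoef (mps_eval f) j = fcoef (\sum_(k < N) malg_eval (mps_coef f k)) j.
Proof.
move=> jN; rewrite fcoef_sum /=.
rewrite (big_ord_widen N (fun k => fcoef (malg_eval (mps_coef f k)) j)) //.
rewrite big_mkcond /=; apply: eq_bigr => k _; case: ltnP => // jk.
by rewrite (order_malg_eval (@mps_coef_homog _ _ f k)).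
Qed.

(** Up to index j, the image of f is the value at T = 1 of the polynomial
    sum_(k <= j) F_k T^k, where F_k is the image of the part of degree k. In the
    product of two such polynomials, the coefficient of T^k is the image of the
    part of degree k of f * g if k <= j, and has order greater than j
    otherwise. *)
Lemma mps_eval_is_monoid_morphism : monoid_morphism mps_eval.
Proof.
split=> [|f g]; apply: fpsP => j.
  rewrite (@fcoef_mps_eval j.+1) // big_ord_recl /= big1 ?addr0 => [|k _].
    by rewrite mps_coef1 rmorph1.
  by rewrite [mps_coef _ _](_ : _ = 0) ?rmorph0.
pose F (h : mps I S) k := malg_eval (mps_coef h k).
pose p (h : mps I S) : {poly fps S} := \poly_(k < j.+1) F h k.
have pE (h : mps I S) i : (i < j.+1)%N -> fcoef (mps_eval h) i = fcoef (p h).[1] i.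
  move=> ij; rewrite (fcoef_mps_eval h ij) horner_poly.
  by congr fcoef; apply: eq_bigr => k _; rewrite expr1n mulr1.
transitivity (fcoef ((p f).[1] * (p g).[1]) j); last first.
  rewrite !fcoefM; apply: eq_bigr => i _; rewrite !pE //.
  by rewrite ltnS leq_subr.
pose N := maxn j.+1 (size (p f * p g)).
rewrite -hornerM (@horner_coef_wide _ N) ?leq_maxr // fcoef_sum.
rewrite (@fcoef_mps_eval N) ?leq_maxl // fcoef_sum; apply: eq_bigr => k _.
rewrite expr1n mulr1 coefM mps_coefM rmorph_sum !fcoef_sum; apply: eq_bigr => i _.
rewrite !coef_poly rmorphM.
have [kj|jk] := ltnP j k; last first.
  have ij : (i < j.+1)%N by have := ltn_ord i; lia.
  by rewrite ij (leq_ltn_trans (leq_subr _ _) (_ : k < j.+1)%N).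
have ho h l : order_ge l (F h l) by apply/order_malg_eval/mps_coef_homog.
have z : fcoef (F f i * F g (k - i)%N) j = 0.
  by rewrite (order_geM (ho f i) (ho g (k - i)%N)) ?subnKC // -ltnS.
by rewrite z; case: ifP; case: ifP; rewrite ?(mulr0, mul0r).
Qed.

HB.instance Definition _ := GRing.isZmodMorphism.Build _ _ mps_eval
  mps_eval_is_zmod_morphism.

Lemma mps_eval_const c : mps_eval (mps_const c) = fps_const c.
Proof.
apply: fpsP => j; rewrite (@fcoef_mps_eval j.+1) // big_ord_recl big1 => [|k _].
  by rewrite addr0 /mps_coef /= /malg_eval mmapC.
by rewrite [mps_coef _ _](_ : _ = 0) ?rmorph0.
Qed.

Lemma mps_eval_var i : mps_eval (mps_var i) = G i.
Proof.
apply: fpsP => j; rewrite (@fcoef_mps_eval j.+2) // big_ord_recl big_ord_recl big1 => [|k _].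
  rewrite /mps_coef /= rmorph0 add0r addr0 /malg_eval mmapU.
  rewrite [X in X * _](_ : _ = 1) ?mul1r; last exact: rmorph1.
  by rewrite /monom_eval mdomU big_seq_fset1 cmUU.
by rewrite [mps_coef _ _](_ : _ = 0) ?rmorph0.
Qed.

(** Continuity: a coefficient of the image depends on finitely many homogeneous
    parts. *)
Lemma mps_eval_closure (P : mps I S -> Prop) f :
  (forall g, P g -> mps_eval g = 0) -> Defs.closure P f -> mps_eval f = 0.
Proof.
move=> hP Cf; apply: fpsP => j; have [g /hP g0 fg] := Cf j.+1.
by rewrite -g0 /=; apply: eq_bigr => k _; rewrite fg.
Qed.

Lemma mps_eval_gen_ideal (P : mps I S -> Prop) f :
  (forall g, P g -> mps_eval g = 0) -> gen_ideal P f -> mps_eval f = 0.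
Proof.
move=> hP [s [hs ->]]; rewrite raddf_sum big_seq big1 // => x /hs /hP x0.
by rewrite /= mps_eval_is_monoid_morphism.2 x0 mulr0.
Qed.

End SeriesEvaluation.

Section Constants.
Variables (I : choiceType) (S : comNzRingType).

Lemma mps_const_is_zmod_morphism : zmod_morphism (@mps_const I S).
Proof.
by move=> c e; apply/val_inj; rewrite [LHS]/= (rmorphB (@malgC {cmonom I} S)) rmorphB.
Qed.

Lemma mps_const_is_monoid_morphism : monoid_morphism (@mps_const I S).
Proof.
split=> [|c e]; apply/val_inj => //.
by rewrite [LHS]/= (rmorphM (@malgC {cmonom I} S)) rmorphM.
Qed.

HB.instance Definition _ := GRing.isZmodMorphism.Build S (mps I S) (@mps_const I S)
  mps_const_is_zmod_morphism.
HB.instance Definition _ := GRing.isMonoidMorphism.Build S (mps I S) (@mps_const I S)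
  mps_const_is_monoid_morphism.

End Constants.

HB.instance Definition _ n (S : comNzRingType) (beta : S) :=
  GRing.RMorphism.copy (fga_const n beta) (fga_pi beta \o @mps_const (lattice n) S).

(** * A character of the formal group algebra *)

Section OneParameterGroup.
Variables (R : comNzRingType) (u v : R).
Hypothesis uv : u * v = 1.

(** The powers of the invertible element u, with the negative ones read off from
    its inverse v. *)
Definition int_pow (z : int) : R := if z is Negz k then v ^+ k.+1 else u ^+ `|z|%N.

Lemma int_powB (a b : nat) : int_pow (a%:Z - b%:Z) = u ^+ a * v ^+ b.
Proof.
have uvX c : u ^+ c * v ^+ c = 1 by rewrite -exprMn uv expr1n.
have [ba|ab] := leqP b a.
  by rewrite subzn //= -{2}(subnK ba) exprD -mulrA uvX mulr1.
have [c bE] : exists c, b = (a + c.+1)%N by exists (b.-1 - a)%N; lia.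
rewrite (_ : a%:Z - b%:Z = Negz c); last by rewrite bE NegzE; lia.
by rewrite bE exprD mulrA uvX mul1r.
Qed.

Lemma int_powD y z : int_pow (y + z) = int_pow y * int_pow z.
Proof.
have diff (x : int) : exists a b : nat, x = a%:Z - b%:Z.
  by case: x => k; [exists k, 0%N; lia|exists 0%N, k.+1; lia].
have [a [b ->]] := diff y; have [c [e ->]] := diff z.
rewrite (_ : _ + _ = (a + c)%N%:Z - (b + e)%N%:Z); last by lia.
by rewrite !int_powB !exprD mulrACA.
Qed.

End OneParameterGroup.

Section PositionCharacter.
Variables (n : nat) (S : comUnitRingType) (beta : S).
Hypothesis beta_unit : beta \is a GRing.unit.

Definition fps_geom (b : S) : fps S := Fps (fun k => b ^+ k).

Lemma fps_geomP b : (1 - fps_const b * fps_var S) * fps_geom b = 1.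
Proof.
apply: fpsP => k; rewrite mulrBl mul1r -mulrA fcoefB fcoef_constM.
case: k => [|k]; first by rewrite fcoefM0 /= mul0r mulr0 subr0.
rewrite [fcoef (fps_var S * _) _]fcoefM (bigD1 (inord 1)) //= inordK // subSS subn0 mul1r.
rewrite big1 ?addr0 ?exprS ?subrr // => i /negPf.
by rewrite -val_eqE /= inordK // => ->; rewrite mul0r.
Qed.

(** The linear form phi with phi(y_a) = a, chosen to be positive on all
    y_b - y_a with a < b. *)
Definition position_sum (lam : lattice n) : int := \sum_a lam 0 a * a%:Z.

Lemma position_sumD lam mu :
  position_sum (lam + mu) = position_sum lam + position_sum mu.
Proof. by rewrite -big_split; apply: eq_bigr => a _; rewrite mxE mulrDl. Qed.

Lemma position_sumN lam : position_sum (- lam) = - position_sum lam.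
Proof. by rewrite -sumrN; apply: eq_bigr => a _; rewrite mxE mulNr. Qed.

Lemma position_sum_ybasis a : position_sum (ybasis a) = a%:Z.
Proof.
rewrite /position_sum (bigD1 a) //= !mxE !eqxx mul1r big1 ?addr0 // => b.
by rewrite mxE eqxx /= => /negPf ->; rewrite mul0r.
Qed.

(** The image of e^lam = 1 - beta x_lam, namely (1 - beta t)^phi(lam). *)
Definition char_series (lam : lattice n) : fps S :=
  int_pow (1 - fps_const beta * fps_var S) (fps_geom beta) (position_sum lam).

Definition var_series (lam : lattice n) : fps S :=
  fps_const beta^-1 * (1 - char_series lam).

Lemma char_seriesD lam mu :
  char_series (lam + mu) = char_series lam * char_series mu.
Proof. by rewrite /char_series position_sumD int_powD //; apply: fps_geomP. Qed.

Lemma char_series0 : char_series 0 = 1.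
Proof. by rewrite /char_series /position_sum big1 // => a _; rewrite mxE mul0r. Qed.

Lemma var_series0 : var_series 0 = 0.
Proof. by rewrite /var_series char_series0 subrr mulr0. Qed.

(** F_C is conjugate to the multiplicative group law through x |-> 1 - beta x, so
    this is the additivity of exponents. *)
Lemma var_seriesD lam mu : var_series (lam + mu) =
  var_series lam + var_series mu - fps_const beta * var_series lam * var_series mu.
Proof.
have bV : fps_const beta * fps_const beta^-1 = 1 by rewrite -rmorphM divrr ?rmorph1.
rewrite /var_series char_seriesD; set c := fps_const beta^-1 in bV *.
rewrite [_ * (c * (1 - char_series lam))]mulrA bV; ring.
Qed.

Lemma order_var_series lam : order_ge 1 (var_series lam).
Proof.
move=> [|//] _; rewrite fcoef_constM fcoefB.
suff -> : fcoef (char_series lam) 0 = 1 by rewrite subrr mulr0.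
have fcoefX0 (f : fps S) k : fcoef f 0 = 1 -> fcoef (f ^+ k) 0 = 1.
  by move=> f0; elim: k => // k IH; rewrite exprS fcoefM0 f0 IH mulr1.
rewrite /char_series /int_pow; case: (position_sum lam) => k; apply: fcoefX0 => //.
by rewrite fcoefB fcoefM0 mulr0 subr0.
Qed.

Lemma var_series_root (a b : 'I_n) : (a < b)%N ->
  fcoef (var_series (- Defs.root (a, b))) 1 = (b - a)%:R.
Proof.
move=> ab; rewrite fcoef_constM /char_series.
have -> : position_sum (- Defs.root (a, b)) = (b - a)%N%:Z.
  rewrite position_sumN position_sumD position_sumN !position_sum_ybasis /=.
  by rewrite opprB -subzn ?(ltnW ab).
rewrite [int_pow _ _ _]/=; set u := 1 - fps_const beta * _.
have u0 : fcoef u 0 = 1 by rewrite fcoefB fcoefM0 mulr0 subr0.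
have u1 : fcoef u 1 = - beta by rewrite fcoefB fcoef_constM /= mulr1 sub0r.
move: u u0 u1 => u u0 u1.
have uX k : fcoef (u ^+ k) 0 = 1 /\ fcoef (u ^+ k) 1 = - (beta *+ k).
  elim: k => [|k [IH0 IH1]]; first by rewrite oppr0.
  rewrite exprS fcoefM0 u0 IH0 mulr1; split=> //.
  rewrite fcoefM !big_ord_recl big_ord0 /= u0 u1 IH0 IH1 mul1r mulr1 addr0.
  by rewrite mulrSr opprD.
rewrite fcoefB (uX _).2 /= sub0r opprK.
by rewrite mulrnAr mulVr.
Qed.

HB.instance Definition _ := GRing.isMonoidMorphism.Build _ _ (mps_eval var_series)
  (mps_eval_is_monoid_morphism order_var_series).

Lemma mps_eval_fga_rel f : fga_rel beta f -> mps_eval var_series f = 0.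
Proof.
case=> [->|[lam [mu ->]]]; first by rewrite (mps_eval_var order_var_series) var_series0.
rewrite rmorphB /= /connective_fgl rmorphB rmorphD !rmorphM /=.
rewrite !(mps_eval_var order_var_series) (mps_eval_const order_var_series).
by rewrite var_seriesD subrr.
Qed.

(** The evaluation kills the closed ideal of relations, that is, it factors
    through the formal group algebra. *)
Lemma mps_eval_fga_pi f : fga_pi beta f = 0 -> mps_eval var_series f = 0.
Proof.
rewrite -(rmorph0 (fga_pi beta)) => /fga_piP; rewrite subr0 => /asboolP.
apply: mps_eval_closure => g; apply: (mps_eval_gen_ideal order_var_series).
exact: mps_eval_fga_rel.
Qed.

Definition neg_root_var (p : 'I_n * 'I_n) : fga n beta := fga_var n beta (- Defs.root p).

(** The image of the product of #|A| variables and of their sum starts in degree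
    #|A| + 1, with coefficient M = (prod_p (p.2 - p.1)) (sum_p (p.2 - p.1)). *)
Lemma fga_prod_sum_roots_torsion (A : {set 'I_n * 'I_n}) (c : S) :
  A != set0 -> (forall p, p \in A -> (p.1 < p.2)%N) ->
  fga_const n beta c * ((\prod_(p in A) neg_root_var p) * \sum_(p in A) neg_root_var p)
    = 0 ->
  exists2 M, (0 < M)%N & c *+ M = 0.
Proof.
move=> A0 hA.
pose f : mps (lattice n) S := mps_const c *
  ((\prod_(p <- enum A) mps_var (- Defs.root p)) * \sum_(p <- enum A) mps_var (- Defs.root p)).
rewrite -!big_enum /= [LHS](_ : _ = fga_pi beta f); last first.
  by rewrite /f !rmorphM rmorph_prod rmorph_sum.
move=> /mps_eval_fga_pi; rewrite !rmorphM rmorph_prod rmorph_sum /=.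
rewrite (mps_eval_const order_var_series).
under eq_bigr do rewrite (mps_eval_var order_var_series).
under [X in _ * (_ * X)]eq_bigr do rewrite (mps_eval_var order_var_series).
move=> /(congr1 (fun f => fcoef f (size (enum A) + 1))); rewrite fcoef_constM.
have [oP cP] := order_ge_prod (enum A) (fun p => order_var_series (- Defs.root p)).
rewrite (fcoefM_order oP); last by apply: order_ge_sum => p _; apply: order_var_series.
rewrite {}cP fcoef_sum.
have lead : {in enum A, forall p, fcoef (var_series (- Defs.root p)) 1 = (p.2 - p.1)%:R}.
  by case=> a b; rewrite mem_enum => /hA; apply: var_series_root.
rewrite (eq_big_seq _ lead) [X in _ * (_ * X)](eq_big_seq _ lead) -natr_prod -natr_sum.
rewrite -natrM mulr_natr !big_enum => cM; eexists; last exact: cM.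
have pos p : p \in A -> (0 < p.2 - p.1)%N by move/hA; rewrite subn_gt0.
rewrite muln_gt0 prodn_cond_gt0 //=.
by have [p pA] := set0Pn _ A0; rewrite (bigD1 p) //= addn_gt0 pos.
Qed.

End PositionCharacter.

(** * The classes indexed by w0 *)

Section LongestClass.
Variables (n d : nat) (fl : flag n d).

Lemma perm_length1 : perm_length (1 : 'S_n) = 0%N.
Proof.
apply/eqP; rewrite cards_eq0; apply/eqP/setP => p; rewrite !inE !perm1.
by apply/negP => /andP[]; lia.
Qed.

Lemma wperm_w0 : wperm (w0 fl) = 1%g.
Proof.
apply: perm_length0; apply/eqP; rewrite -leqn0 -perm_length1.
apply: (wpermP (w0 fl)).2; apply/val_inj/eq_from_tnth => k.
by rewrite tnth_mktuple invg1 perm1.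
Qed.

Lemma reduced_word_w0 : reduced_word (wperm (w0 fl)) = [::].
Proof. by apply/size0nil; rewrite size_reduced_word wperm_w0 perm_length1. Qed.

Lemma conn_segre_at_w0 (S : comNzRingType) (beta : S) :
  conn_segre beta (w0 fl) = conn_segre_w0 fl beta.
Proof. by rewrite /conn_segre reduced_word_w0. Qed.

Lemma mot_segre_at_w0 (S : comNzRingType) (beta : S) :
  mot_segre beta (w0 fl) = mot_segre_w0 fl beta.
Proof. by rewrite /mot_segre reduced_word_w0. Qed.

(** The pair straddling the last step i_d of the flag is a witness; this is where
    d >= 1 enters. *)
Lemma SigmaTheta_neq0 : (1 <= d)%N -> SigmaTheta fl != set0.
Proof.
case: d fl => // e fl' _.
have lt1 : (fl' e < fl' e.+1)%N by apply: fdim_lt.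
have lt2 : (fl' e.+1 < n)%N by rewrite -[X in (_ < X)%N](fdim_n fl'); apply: fdim_lt.
have lt3 : ((fl' e.+1).-1 < n)%N by lia.
apply/set0Pn; exists (Ordinal lt3, Ordinal lt2); rewrite inE /=.
apply/andP; split; first by lia.
by apply/existsP; exists ord_max => /=; lia.
Qed.

Lemma SigmaTheta_lt p : p \in SigmaTheta fl -> (p.1 < p.2)%N.
Proof. by rewrite inE => /andP[]. Qed.

End LongestClass.

(** * Comparison of the two products *)

Lemma cross_mul (R : comUnitRingType) (B a c d1 d2 : R) :
  a / d1 = B^-1 * (c / d2) ->
  B \is a GRing.unit -> d1 \is a GRing.unit -> d2 \is a GRing.unit ->
  B * a * d2 = c * d1.
Proof.
move=> e uB u1 u2; rewrite -[a](divrK u1) e -!mulrA (mulVKr uB).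
by rewrite [d1 * d2]mulrC mulKr.
Qed.

Section CompareLongestClass.
Variables (n : nat) (S : comUnitRingType) (beta : S) (A : {set 'I_n * 'I_n}).
Hypothesis beta_unit : beta \is a GRing.unit.
Local Notation K := (segre_ring n beta).
Local Notation x p := (xvar beta (- Defs.root p)).
Local Notation e p := (eK beta (- Defs.root p)).
Local Notation q2 := (xq n beta ^+ 2).
Let b : fga n beta := fga_const n beta beta.
Let Pi : fga n beta := \prod_(p in A) neg_root_var beta p.
Let Sg : fga n beta := \sum_(p in A) neg_root_var beta p.

Lemma betaK_unit : betaK n beta \is a GRing.unit.
Proof.
apply/unitrPr; exists (of_fga_q (fps_const (fga_const n beta beta^-1))).
by rewrite /betaK -!rmorphM divrr ?rmorph1.
Qed.

(** A factor of the denominators: c = 1 - x_(-a) for the connective classes, and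
    c = e^(-a) for the others. *)
Definition den (c : fga n beta) : fga_q n beta := 1 - fps_var _ ^+ 2 * fps_const c.

Lemma of_denE c : of_fga_q (den c) = 1 - q2 * of_fga_q (fps_const c) :> K.
Proof. by rewrite rmorphB rmorph1 rmorphM rmorphXn. Qed.

Lemma regular_prod_den (c : 'I_n * 'I_n -> fga n beta) :
  regular (\prod_(p in A) den (c p)).
Proof. by apply: regular_fcoef0; have [] := fcoef_prod_X2 (index_enum _) (mem A) c. Qed.

Lemma of_prod_frac (y c : 'I_n * 'I_n -> fga n beta) :
  \prod_(p in A) (of_fga_q (fps_const (y p)) / (1 - q2 * of_fga_q (fps_const (c p))))
  = of_fga_q (fps_const (\prod_(p in A) y p)) /
    of_fga_q (\prod_(p in A) den (c p)) :> K.
Proof.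
rewrite big_split /= -!rmorph_prod; congr (_ * _); rewrite rmorph_prod -prodrV.
  by apply: eq_bigr => p _; rewrite -of_denE.
move=> p _; apply: of_fga_q_unit; apply: regular_fcoef0.
by rewrite fcoefB fcoef_X2M0 subr0.
Qed.

(** After clearing denominators, the equality is
      b^L Pi D2 = b^#|A| Pi D1
    between series in q, where D1 and D2 are products of [den]. The coefficient
    of q^0 is the first conclusion; the coefficients of q^2 in D1 and D2 are
    Sg - #|A| and b Sg - #|A|, and the terms with #|A| cancel by the first
    conclusion. *)
Lemma longest_class_compare L :
  \prod_(p in A) (x p / (1 - q2 * (1 - x p))) =
    betaK n beta ^- L * \prod_(p in A) ((1 - e p) / (1 - q2 * e p)) ->
  b ^+ L * Pi = b ^+ #|A| * Pi /\ b ^+ L.+1 * Pi * Sg = b ^+ #|A| * Pi * Sg.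
Proof.
have xE p : x p = of_fga_q (fps_const (neg_root_var beta p)) by [].
have x1E p : 1 - x p = of_fga_q (fps_const (1 - neg_root_var beta p)).
  by rewrite rmorphB rmorph1 rmorphB rmorph1.
have eE p : e p = of_fga_q (fps_const (1 - b * neg_root_var beta p)).
  by rewrite rmorphB rmorph1 rmorphM rmorphB rmorph1 rmorphM.
have e1E p : 1 - e p = of_fga_q (fps_const (b * neg_root_var beta p)).
  by rewrite /eK subKr !rmorphM.
under eq_bigr do rewrite x1E xE.
under [in RHS]eq_bigr do rewrite e1E eE.
rewrite !of_prod_frac big_split prodr_const /=.
rewrite -/Pi; set D1 := \prod_(p in A) den (1 - neg_root_var _ _).
set D2 := \prod_(p in A) den (1 - b * _).
have bX : betaK n beta ^+ L = of_fga_q (fps_const (b ^+ L)) by rewrite !rmorphXn.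
move/cross_mul; rewrite unitrX ?betaK_unit // !of_fga_q_unit; try exact: regular_prod_den.
move=> /(_ isT isT isT); rewrite bX -!rmorphM => /loc_const_inj DE.
have [D10 D12] := fcoef_prod_X2 (index_enum _) (mem A) (fun p => 1 - neg_root_var beta p).
have [D20 D22] := fcoef_prod_X2 (index_enum _) (mem A) (fun p => 1 - b * neg_root_var beta p).
have := congr1 (fun f => fcoef f 0) DE; have := congr1 (fun f => fcoef f 2) DE.
rewrite !fcoef_constM D10 D20 D12 D22 !mulr1 => E2 E0; split=> //.
(* E0 cancels the terms coming from the constants 1 in both sums. *)
move: E2; rewrite !sumrB -mulr_sumr -/Sg -/Pi !mulrN !mulrBr E0.
move=> /oppr_inj/addrI/oppr_inj <-.
by rewrite exprSr (mulrAC _ b) E0 mulrA.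
Qed.

End CompareLongestClass.

(** * Conclusion *)

Lemma lbeta_expr_inj a b M : (0 < M)%N -> (lbeta ^+ a - lbeta ^+ b) *+ M = 0 -> a = b.
Proof.
move=> M0; rewrite /lbeta -!rmorphXn -rmorphB -rmorphMn -(rmorph0 (loc_const _)).
move=> /loc_const_inj/eqP.
rewrite -mulr_natr mulf_eq0 -polyC_natr polyC_eq0 Num.Theory.pnatr_eq0 eqn0Ngt M0 orbF.
rewrite subr_eq0 => /eqP/(congr1 (fun p : {poly int} => size p)).
by rewrite !size_polyXn => -[].
Qed.

Theorem lemma1p5 (n d : nat) (hd : (1 <= d)%N) (fl : flag n d) :
  ~ (forall w : Gamma fl,
       @conn_segre n d fl laurent lbeta w =
       @beta_homogenization n d fl laurent lbeta w).
Proof.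
move=> /(_ (w0 fl)); rewrite conn_segre_at_w0 => /ffunP/(_ (w0 fl)).
rewrite !ffunE mot_segre_at_w0 ffunE eqxx.
set L := ell _; set A := SigmaTheta fl.
move=> /(longest_class_compare lbeta_unit)[E1 E2].
pose PS := (\prod_(p in A) neg_root_var lbeta p) * \sum_(p in A) neg_root_var lbeta p.
have expr_eq k : fga_const n lbeta lbeta ^+ k * PS = fga_const n lbeta lbeta ^+ #|A| * PS ->
    k = #|A|.
  move=> kE; have : fga_const n lbeta (lbeta ^+ k - lbeta ^+ #|A|) * PS = 0.
    by rewrite rmorphB !rmorphXn mulrBl kE subrr.
  by case/(fga_prod_sum_roots_torsion lbeta_unit (SigmaTheta_neq0 fl hd) (@SigmaTheta_lt _ _ fl))
    => M M0 /(lbeta_expr_inj M0).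
have LA : L = #|A| by apply: expr_eq; rewrite /PS !mulrA E1.
have SLA : L.+1 = #|A| by apply: expr_eq; rewrite /PS !mulrA E2.
by move: SLA; rewrite LA => /esym/n_Sn.
Qed.
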